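(* Let $\mathrm{x}_1^\infty$ and $\mathrm{y}_1^\infty$ be one-sided random processes (arbitrarily distributed) that are jointly stationary, and suppose that $\mathrm{y}_1^\infty$ is causally related to $\mathrm{x}_1^\infty$ in the sense that $$\mathrm{x}_{k+1}^{\infty}\longleftrightarrow \mathrm{x}_1^k\longleftrightarrow \mathrm{y}_1^k,\qquad k=1,2,\ldots.$$ Then $$\mathrm{x}_{k+1}^{\infty}\longleftrightarrow \mathrm{x}(k)\longleftrightarrow \mathrm{y}(k),\qquad \forall k\in\{1,2,\ldots\}.$$
   Context: For a process, $\mathrm{x}_j^k$ denotes $(\mathrm{x}(j),\ldots,\mathrm{x}(k))$ and $\mathrm{x}_j^\infty$ denotes $(\mathrm{x}(j),\mathrm{x}(j+1),\ldots)$. The samples $\mathrm{x}(i)$ take values in a source alphabet $\mathcal{X}$ and the samples $\mathrm{y}(i)$ in a reconstruction alphabet $\mathcal{Y}$. The notation $\mathrm{a}\longleftrightarrow \mathrm{c}\longleftrightarrow \mathrm{b}$ (Markov chain) means that $\mathrm{a}$ and $\mathrm{b}$ are conditionally independent given $\mathrm{c}$. The processes $\mathrm{x}_1^\infty$ and $\mathrm{y}_1^\infty$ are jointly stationary if for every $\ell\in\mathbb{N}$ the distribution of $(\mathrm{x}_k^{k+\ell},\mathrm{y}_k^{k+\ell})$ does not depend on $k$, for $k=1,2,\ldots$. *)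

(* Defs.v *)
From HB Require Import structures.
From mathcomp Require Import all_boot all_order all_algebra.
From mathcomp Require Import all_classical all_reals all_analysis.

Set Implicit Arguments.
Unset Strict Implicit.
Unset Printing Implicit Defensive.

Local Open Scope classical_set_scope.
Local Open Scope ring_scope.
Local Open Scope ereal_scope.

(* [f] is a version of the conditional probability P(A | G), for a
   sub-sigma-algebra [G]. *)
Definition is_cond_prob (d : measure_display) (T : measurableType d)
    (R : realType) (P : probability T R) (G : set (set T)) (A : set T)
    (f : T -> R) : Prop :=
  [/\ preimage_set_system setT f measurable `<=` G,
      P.-integrable setT (EFin \o f) &
      forall C, G C -> \int[P]_(w in C) (f w)%:E = P (A `&` C)].

(* G1 and G2 are conditionally independent given G:
   P(A `&` B | G) = P(A | G) P(B | G) almost surely, for all A in G1, B in G2.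
   Versions of conditional probabilities always exist and are unique up to
   P-null sets, so "for some versions" and "for all versions" agree. *)
Definition cond_indep (d : measure_display) (T : measurableType d)
    (R : realType) (P : probability T R) (G1 G G2 : set (set T)) : Prop :=
  forall A B, G1 A -> G2 B ->
    exists f g h : T -> R,
      [/\ is_cond_prob P G (A `&` B) f, is_cond_prob P G A g,
          is_cond_prob P G B h & f = (g \* h)%R %[ae P in setT]].

(* The sigma-algebra on the sample space generated by (x(i), i in I). *)
Definition sigma_process (d dX : measure_display) (T : measurableType d)
    (X : measurableType dX) (R : realType) (P : probability T R)
    (x : nat -> {RV P >-> X}) (I : set nat) : set (set T) :=
  <<s \bigcup_(i in I) preimage_set_system setT (x i) measurable >>.

(* Random elements enter a Markov chain a <-> c <-> b through the
   sigma-algebras that they generate. *)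
Definition markov_chain (d dA dC dB : measure_display) (T : measurableType d)
    (XA : measurableType dA) (XC : measurableType dC) (XB : measurableType dB)
    (R : realType) (P : probability T R)
    (a : nat -> {RV P >-> XA}) (I : set nat)
    (c : nat -> {RV P >-> XC}) (J : set nat)
    (b : nat -> {RV P >-> XB}) (K : set nat) : Prop :=
  cond_indep P (sigma_process a I) (sigma_process c J) (sigma_process b K).

(* The block (x(k), ..., x(k+l)). *)
Definition block (d dX : measure_display) (T : measurableType d)
    (X : measurableType dX) (R : realType) (P : probability T R)
    (x : nat -> {RV P >-> X}) (k l : nat) (w : T) : l.+1.-tuple X :=
  [tuple x (k + i)%N w | i < l.+1].

(* Time starts at 1; the samples of index 0 are ignored. Laws are compared on
   the product sigma-algebra. *)
Definition jointly_stationary (d dX dY : measure_display)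
    (T : measurableType d) (X : measurableType dX) (Y : measurableType dY)
    (R : realType) (P : probability T R)
    (x : nat -> {RV P >-> X}) (y : nat -> {RV P >-> Y}) : Prop :=
  forall l k k' : nat, (1 <= k)%N -> (1 <= k')%N ->
  forall D : set (l.+1.-tuple X * l.+1.-tuple Y), measurable D ->
    pushforward P (fun w => (block x k l w, block y k l w)) D =
    pushforward P (fun w => (block x k' l w, block y k' l w)) D.

(* Main.v *)
(* Causality is needed only at time 1, where it reads x_2^oo <-> x(1) <-> y(1).
   By joint stationarity (x_k^oo, y(k)) has the same law as (x_1^oo, y(1)), and
   conditional independence depends only on the joint law: by the Doob-Dynkin
   lemma the conditional probabilities are functions of the path, which remain
   versions after the path is replaced by another one with the same law. *)
Require Import Defs.
From HB Require Import structures.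
From mathcomp Require Import all_boot all_order all_algebra.
From mathcomp Require Import all_classical all_reals all_analysis.
From mathcomp Require Import measurable_realfun.

Local Open Scope classical_set_scope.

(** * Conditional probabilities under a change of the underlying probability space *)

Section transfer.
Local Open Scope ring_scope.
Local Open Scope ereal_scope.
Set Implicit Arguments.
Unset Strict Implicit.
Import Order.TTheory GRing.Theory Num.Theory.

(* The factor is z |-> inf {q rational : z in B q}, where [f < q] is the
   preimage of B q under Phi. *)
Lemma doob_dynkin (T : Type) (d : measure_display) (Z : measurableType d)
    (R : realType) (Phi : T -> Z) (f : T -> R) :
  preimage_set_system setT f measurable
    `<=` preimage_set_system setT Phi measurable ->
  exists2 phi : Z -> R, measurable_fun setT phi & f = phi \o Phi.
Proof.
move=> fPhi.
have BP q :
    exists B : set Z, measurable B /\ Phi @^-1` B = f @^-1` `]-oo, ratr q[.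
  have /fPhi[B mB BE] :
      preimage_set_system setT f measurable (f @^-1` `]-oo, ratr q[).
    by exists `]-oo, ratr q[%classic; [exact: measurable_itv|rewrite setTI].
  by exists B; split=> //; rewrite -BE setTI.
pose B q := projT1 (cid (BP q)).
have mB q : measurable (B q) by rewrite /B; case: cid => ? [].
have BE q w : B q (Phi w) <-> (f w < ratr q)%R.
  rewrite /B; case: cid => /= C [_ CE].
  have -> : C (Phi w) = (Phi @^-1` C) w by [].
  by rewrite CE /= in_itv.
(* The rationals are enumerated by their codes. The default [+oo], for a number that codes no
   rational or for [z] outside [B q], is neutral in the infimum. *)
pose u n z : \bar R := if unpickle n is Some q then
  (if z \in B q then (ratr q)%:E else +oo) else +oo.
pose phi z := ereal_inf (range (u^~ z)).
have mphi : measurable_fun setT phi.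
  have -> : phi = fun z => einfs (u^~ z) 0%N.
    apply/funext => z; rewrite /phi /einfs /sdrop; congr ereal_inf.
    by apply/seteqP; split => [_ [n _ <-]|_ [n _ <-]]; exists n.
  apply: measurable_fun_einfs => n; rewrite /u.
  case: unpickle => [q|]; last exact: measurable_cst.
  apply: measurable_fun_ifT => //.
  apply: (measurable_fun_bool true); rewrite setTI.
  rewrite (_ : _ @^-1` _ = B q)//.
  by apply/seteqP; split=> z; [exact: set_mem|exact: mem_set].
(* The infimum may be infinite off the range of [Phi], where the value chosen by [fine] is
   irrelevant; on the range it equals [f w]. *)
exists (fine \o phi).
  by apply: measurableT_comp => //; exact: fine_measurable.
apply/funext => w /=.
suff -> : phi (Phi w) = (f w)%:E by [].
apply/eqP; rewrite eq_le; apply/andP; split.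
  apply/lee_addgt0Pr => e e0.
  have /rat_in_itvoo[q] : (f w < f w + e)%R by rewrite ltrDl.
  rewrite in_itv/= => /andP[fq qe].
  apply: ge_ereal_inf; exists (ratr q)%:E; last by rewrite -EFinD lee_fin ltW.
  exists (pickle q) => //; rewrite /u pickleK.
  by rewrite mem_set //; exact/BE.
apply: le_ereal_inf_tmp => _ [n _ <-]; rewrite /u.
case: unpickle => [q|]; last by rewrite leey.
case: ifPn => [|_]; last by rewrite leey.
by rewrite inE => /BE fq; rewrite lee_fin ltW.
Qed.

(** Integrability and the defining identity only involve integrals of functions of [Phi]. A change
    of variables turns them into integrals against the common law on [Z], and a second one carries
    them over to [Psi]. *)
Lemma is_cond_prob_eq_law (d d' dZ : measure_display) (T : measurableType d)
    (T' : measurableType d') (Z : measurableType dZ) (R : realType)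
    (P : probability T R) (Q : probability T' R)
    (Phi : {RV P >-> Z}) (Psi : {RV Q >-> Z}) (F : set (set Z)) (A : set Z)
    (phi : Z -> R) :
  (forall S, measurable S -> distribution P Phi S = distribution Q Psi S) ->
  F `<=` measurable -> measurable A ->
  preimage_set_system setT phi measurable `<=` F ->
  is_cond_prob P (preimage_set_system setT Phi F) (Phi @^-1` A) (phi \o Phi) ->
  is_cond_prob Q (preimage_set_system setT Psi F) (Psi @^-1` A) (phi \o Psi).
Proof.
move=> PhiPsi Fm mA phiF [_ iphi Pphi].
have mphi : measurable_fun setT phi.
  by move=> _ B mB; apply/Fm/phiF; exists B.
have mEphi : measurable_fun setT (EFin \o phi) by exact/measurable_EFinP.
have mphiPsi : measurable_fun setT (EFin \o (phi \o Psi)).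
  by apply/measurable_EFinP; apply: measurableT_comp.
have iphiPsi : Q.-integrable setT (EFin \o (phi \o Psi)).
  apply/integrableP; split => //.
  have := @ge0_integral_pushforward _ _ _ _ _ Psi (measurable_funPT Psi) Q
    setT (fun z => `|(phi z)%:E|) measurableT.
  rewrite preimage_setT => <-//; last exact: measurableT_comp.
  rewrite (eq_measure_integral (distribution P Phi)); last first.
    by move=> S mS _; exact/esym/PhiPsi.
  rewrite ge0_integral_pushforward//; last exact: measurableT_comp.
  by have /integrableP[] := iphi.
split=> // [_ [B mB <-]|_ [C FC <-]].
  exists (phi @^-1` B); first by apply: phiF; exists B => //; rewrite setTI.
  by rewrite comp_preimage.
have mC : measurable C by exact: Fm.
rewrite setTI.
have := @integral_pushforward _ _ _ _ _ Psi (measurable_funPT Psi) Q C _ mEphi.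
move=> /(_ (integrableS measurableT (measurable_funPTI _ mC)
  (@subsetT _ _) iphiPsi) mC).
move=> /= <-.
rewrite (eq_measure_integral (distribution P Phi)); last first.
  by move=> S mS _; exact/esym/PhiPsi.
rewrite integral_pushforward//; last first.
  exact: (integrableS measurableT (measurable_funPTI _ mC) (@subsetT _ _) iphi).
have -> : Psi @^-1` A `&` Psi @^-1` C = Psi @^-1` (A `&` C) by [].
(* Both sides now live on [T]: the integral of [phi \o Phi] over the preimage of [C], and the
   probability that [Phi] lies in both [A] and [C]. *)
rewrite -[RHS]/(distribution Q Psi (A `&` C)) -PhiPsi; last exact: measurableI.
by rewrite Pphi//; exists C => //; rewrite setTI.
Qed.

(** The conditioning sigma-algebra has the form [<<s H>>] so that [Z] can be equipped with it in
    place of its own. The Doob-Dynkin factors are then measurable for [<<s H>>] itself, as the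
    transferred versions must be. *)
Lemma cond_indep_eq_law (d d' dZ : measure_display) (T : measurableType d)
    (T' : measurableType d') (Z : measurableType dZ) (R : realType)
    (P : probability T R) (Q : probability T' R)
    (Phi : {RV P >-> Z}) (Psi : {RV Q >-> Z}) (F1 H F2 : set (set Z)) :
  (forall S, measurable S -> distribution P Phi S = distribution Q Psi S) ->
  F1 `<=` measurable -> <<s H >> `<=` measurable -> F2 `<=` measurable ->
  cond_indep P (preimage_set_system setT Phi F1)
    (preimage_set_system setT Phi <<s H >>) (preimage_set_system setT Phi F2) ->
  cond_indep Q (preimage_set_system setT Psi F1)
    (preimage_set_system setT Psi <<s H >>) (preimage_set_system setT Psi F2).
Proof.
move=> PhiPsi F1m Hm F2m indep _ _ [A FA <-] [B FB <-].
have [mA mB] : measurable A /\ measurable B by split; [exact: F1m|exact: F2m].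
have [||f [g [h [Pf Pg Ph fgh]]]] := indep (Phi @^-1` A) (Phi @^-1` B).
- by exists A => //; rewrite setTI.
- by exists B => //; rewrite setTI.
rewrite !setTI.
pose factors (k : T -> R) := exists2 kk : Z -> R,
  preimage_set_system setT kk measurable `<=` <<s H >> & k = kk \o Phi.
have factor k : preimage_set_system setT k measurable `<=`
    preimage_set_system setT Phi <<s H >> -> factors k.
  move=> kPhi.
  have [kk mkk ->] := @doob_dynkin T _ (g_sigma_algebraType H) R Phi k kPhi.
  by exists kk => // _ [S mS <-]; exact: mkk.
have [f' Ff' fE] : factors f by apply: factor; case: Pf.
have [g' Fg' gE] : factors g by apply: factor; case: Pg.
have [h' Fh' hE] : factors h by apply: factor; case: Ph.
rewrite {}fE {}gE {}hE in Pf Pg Ph fgh.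
exists (f' \o Psi), (g' \o Psi), (h' \o Psi); split.
- exact: (is_cond_prob_eq_law PhiPsi Hm (measurableI _ _ mA mB) Ff' Pf).
- exact: (is_cond_prob_eq_law PhiPsi Hm mA Fg' Pg).
- exact: (is_cond_prob_eq_law PhiPsi Hm mB Fh' Ph).
have mfun (k : Z -> R) : preimage_set_system setT k measurable `<=` <<s H >> ->
    measurable_fun setT k.
  by move=> kH _ S mS; apply: (Hm _ (kH _ _)); exists S.
(* The product formula fails on the preimage of [N], a measurable set of [Z]. Its law is zero
   through [Phi], hence also through [Psi]. *)
pose N := [set z | f' z != (g' z * h' z)%R].
have mN : measurable N.
  rewrite (_ : N = (f' \- (g' \* h'))%R @^-1` (~` [set 0%R])); last first.
    by apply/seteqP; split => z /=; rewrite /N/= -subr_eq0 => /eqP.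
  rewrite -[X in measurable X]setTI.
  have : measurable_fun setT (f' \- (g' \* h'))%R.
    by apply: measurable_funB; [|apply: measurable_funM]; exact: mfun.
  by apply => //; apply: measurableC; exact: measurable_set1.
have PN : distribution P Phi N = 0.
  rewrite /distribution /pushforward; apply: measure_negligible.
    exact: measurable_funPTI.
  have [M [mM PM sM]] := fgh; exists M; split => // w /eqP Nw; apply: sM => /= E.
  exact/Nw/E.
exists (Psi @^-1` N); split.
- exact: measurable_funPTI.
- by rewrite -[LHS]/(distribution Q Psi N) -PhiPsi.
by move=> w /= E; apply/eqP => E'; apply: E => _; exact: E'.
Qed.

(** The counterpart of [sigma_process] for plain maps: the coordinates of a path are fixed before
    any measure is put on the paths. *)
Definition sigma_family (U : Type) (d : measure_display) (X : measurableType d)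
    (c : nat -> U -> X) (I : set nat) : set (set U) :=
  <<s \bigcup_(i in I) preimage_set_system setT (c i) measurable >>.

Lemma sigma_family_sub (d dZ : measure_display) (X : measurableType d)
    (Z : measurableType dZ) (c : nat -> Z -> X) (I : set nat) :
  (forall i, measurable_fun setT (c i)) -> sigma_family c I `<=` measurable.
Proof.
move=> mc; apply: smallest_sub; first exact: sigma_algebra_measurable.
by move=> _ [i _ [A mA <-]]; exact: mc.
Qed.

(** Generating a sigma-algebra commutes with taking preimages, so comparing generators suffices. The
    hypothesis is restricted to [I] because [present_coord] matches the shifted y only at index
    0. *)
Lemma sigma_process_shift (d dX dZ : measure_display) (T : measurableType d)
    (X : measurableType dX) (Z : measurableType dZ) (R : realType)
    (P : probability T R) (x : nat -> {RV P >-> X})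
    (c : nat -> Z -> X) (Phi : T -> Z) (k : nat) (I : set nat) :
  (forall i w, I i -> c i (Phi w) = x (k + i)%N w) ->
  sigma_process x (addn k @` I) = preimage_set_system setT Phi
    (sigma_family c I).
Proof.
move=> cx; rewrite -g_sigma_preimageE /sigma_process; congr (<<s _ >>).
have cxE i A : I i -> x (k + i)%N @^-1` A = Phi @^-1` (c i @^-1` A).
  by move=> Ii; apply/seteqP; split=> w /=; rewrite cx.
apply/seteqP; split=> [_ [_ [i Ii <-] [A mA <-]]|_ [_ [i Ii [A mA <-]] <-]].
  exists (c i @^-1` A); first by exists i => //; exists A => //; rewrite setTI.
  by rewrite cxE.
exists (k + i)%N; first by exists i.
by exists A => //; rewrite cxE// !setTI.
Qed.

End transfer.

(** * The space of paths and the law of the shifted path *)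

Section path_space.
Local Open Scope ereal_scope.
Set Implicit Arguments.
Unset Strict Implicit.
Import Order.TTheory.
Context (dX dY : measure_display) (X : measurableType dX) (Y : measurableType dY).

(* A single sample of y is recorded, at the first time of the path of x. *)
Definition cylinders : set (set ((nat -> X) * Y)) :=
  [set C | exists (l : nat) (A : nat -> set X) (B : set Y),
    [/\ forall i, measurable (A i), forall i, (l < i)%N -> A i = setT,
        measurable B & C = [set z | (forall i, A i (z.1 i)) /\ B z.2]]].

Lemma cylindersI : setI_closed cylinders.
Proof.
move=> _ _ [l [A [B [mA Al mB ->]]]] [l' [A' [B' [mA' Al' mB' ->]]]].
exists (maxn l l'), (fun i => A i `&` A' i), (B `&` B'); split.
- by move=> i; exact: measurableI.
- by move=> i; rewrite gtn_max => /andP[li l'i]; rewrite Al// Al'// setIT.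
- exact: measurableI.
apply/seteqP; split => [z [[Az Bz] [A'z B'z]]|z [Az [Bz B'z]]] /=.
  by split=> // i; split.
by split; split=> // i; have [] := Az i.
Qed.

(** This is the product sigma-algebra, presented by a generating family closed under intersection,
    on which a finite measure is determined. *)
Definition path_space := g_sigma_algebraType cylinders.
HB.instance Definition _ := Measurable.on path_space.

Definition coord (i : nat) (z : path_space) : X := z.1 i.

(* The index is ignored, so that y(k) is also a family indexed by time. *)
Definition present_coord (i : nat) (z : path_space) : Y := z.2.

Lemma measurable_coord i : measurable_fun setT (coord i).
Proof.
move=> _ A mA; rewrite setTI; apply: sub_sigma_algebra.
exists i, (fun j => if j == i then A else setT), setT; split=> //.
- by move=> j; case: ifP.
- by move=> j ij; rewrite gtn_eqF.
apply/seteqP; split => [z Az|z [/(_ i)]]; last by rewrite eqxx.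
by split=> // j; case: eqP => // ->.
Qed.

Lemma measurable_present_coord i : measurable_fun setT (present_coord i).
Proof.
move=> _ B mB; rewrite setTI; apply: sub_sigma_algebra.
exists 0%N, (fun=> setT), B; split=> //.
by apply/seteqP; split=> [z Bz|z []].
Qed.

Context (d : measure_display) (T : measurableType d) (R : realType)
  (P : probability T R) (x : nat -> {RV P >-> X}) (y : nat -> {RV P >-> Y}).

(** Coordinate 0 is the present sample x(k), so the strict future sits at the positive indices. *)
Definition shifted_path (k : nat) (w : T) : path_space :=
  (fun i => x (k + i)%N w, y k w).

Lemma measurable_shifted_path k : measurable_fun setT (shifted_path k).
Proof.
apply: (measurability (cylinders : set (set path_space))) => //.
move=> _ [_ [l [A [B [mA _ mB ->]]]] <-].
rewrite setTI (_ : _ @^-1` _ =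
  (\bigcap_i (x (k + i)%N @^-1` A i)) `&` (y k @^-1` B)); last first.
  apply/seteqP; split=> [w [Aw Bw]|w [Aw Bw]]; split=> // i *; first exact: Aw.
  exact: (Aw i).
apply: measurableI; last exact: measurable_funPTI.
apply: bigcap_measurable => //= i _.
exact: measurable_funPTI.
Qed.

HB.instance Definition _ k :=
  isMeasurableFun.Build _ _ _ _ (shifted_path k) (measurable_shifted_path k).

(** By uniqueness of measures it is enough to compare the laws on cylinders, and a cylinder
    constrains only a finite block, to which stationarity applies. *)
Lemma shifted_path_law k k' (S : set path_space) : jointly_stationary x y ->
  (1 <= k)%N -> (1 <= k')%N -> measurable S ->
  distribution P (shifted_path k) S = distribution P (shifted_path k') S.
Proof.
move=> xy k1 k'1.
apply: (measure_unique (cylinders : set (set path_space))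
  (fun=> [set: path_space])) => //.
- exact: cylindersI.
- move=> _; exists 0%N, (fun=> setT), setT; split => //.
  by apply/seteqP; split.
- by apply/seteqP; split=> // z _; exists 0%N.
- move=> _ [l [A [B [mA Al mB ->]]]].
  (* The cylinder as an event on blocks of length [l.+1]; of the y block only the first entry, y(j),
     is constrained. *)
  pose D : set (l.+1.-tuple X * l.+1.-tuple Y) :=
    (\bigcap_(i : 'I_l.+1) ((fun u => tnth u i) @^-1` A i)) `*`
    ((fun v => tnth v ord0) @^-1` B).
  have mD : measurable D.
    apply: measurableX.
      apply: fin_bigcap_measurable => // i _.
      rewrite -[X in measurable X]setTI.
      exact: (measurable_tnth i).
    rewrite -[X in measurable X]setTI.
    exact: (measurable_tnth ord0).
  have pathD j :
      shifted_path j @^-1` [set z | (forall i, A i (z.1 i)) /\ B z.2] =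
      (fun w => (block x j l w, block y j l w)) @^-1` D.
    apply/seteqP; split=> w [/= Aw Bw].
      split=> [i _|]; rewrite /= tnth_mktuple ?addn0//; exact: Aw.
    split=> [i|]; last by move: Bw; rewrite tnth_mktuple addn0.
    have [li|il] := ltnP l i; first by rewrite Al.
    have := Aw (Ordinal (il : (i < l.+1)%N)) Logic.I.
    by rewrite /= tnth_mktuple.
  have lawD j : distribution P (shifted_path j)
        [set z | (forall i, A i (z.1 i)) /\ B z.2] =
      pushforward P (fun w => (block x j l w, block y j l w)) D.
    by rewrite /pushforward -pathD.
  exact: etrans (lawD k) (etrans (xy l k k' k1 k'1 D mD) (esym (lawD k'))).
(* The exhausting sequence is constantly the whole space, which has mass at most 1. *)
- move=> _; apply: le_lt_trans (ltry 1%R).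
  exact: (probability_le1 (distribution P (shifted_path k)) measurableT).
Qed.

End path_space.

Theorem theorem2 (d dX dY : measure_display) (T : measurableType d)
    (X : measurableType dX) (Y : measurableType dY) (R : realType)
    (P : probability T R)
    (x : nat -> {RV P >-> X}) (y : nat -> {RV P >-> Y})
    (stationary_xy : jointly_stationary x y)
    (causal_xy : forall k : nat, (1 <= k)%N ->
       markov_chain x [set i : nat | (k < i)%N]
                    x [set i : nat | (1 <= i <= k)%N]
                    y [set i : nat | (1 <= i <= k)%N]) :
  forall k : nat, (1 <= k)%N ->
    markov_chain x [set i : nat | (k < i)%N] x [set k] y [set k].
Proof.
move=> k k1.
have future j : [set i | (j < i)%N] = addn j @` [set i | (0 < i)%N].
  apply/seteqP; split=> [i /= ji|_ [i /= i0 <-]].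
    by exists (i - j)%N; rewrite /= ?subn_gt0// subnKC// ltnW.
  by rewrite /= -addn1 leq_add2l.
have present j : [set j] = addn j @` [set 0%N] by rewrite image_set1 addn0.
(* At time 1 the past up to the present is the present alone, so causality there is already the
   desired chain. *)
have now : [set i : nat | (1 <= i <= 1)%N] = [set 1%N].
  by apply/seteqP; split=> i /=; [rewrite -eqn_leq => /eqP|move=> ->].
have pathx (I : set nat) j i w :
    I i -> coord i (shifted_path x y j w) = x (j + i)%N w by [].
have pathy j i w :
    [set 0%N] i -> present_coord i (shifted_path x y j w) = y (j + i)%N w.
  by move=> ->; rewrite addn0.
(* The three families on the path space do not depend on [j], so the chains at times 1 and [k]
   differ only in the map along which they are pulled back. *)
have shiftE j : markov_chain x [set i | (j < i)%N] x [set j] y [set j] =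
    cond_indep P
      (preimage_set_system setT (shifted_path x y j)
        (sigma_family (@coord _ _ X Y) [set i | (0 < i)%N]))
      (preimage_set_system setT (shifted_path x y j)
        (sigma_family (@coord _ _ X Y) [set 0%N]))
      (preimage_set_system setT (shifted_path x y j)
        (sigma_family (@present_coord _ _ X Y) [set 0%N])).
  rewrite /markov_chain (future j) (present j).
  by rewrite !(sigma_process_shift (pathx _ j)) (sigma_process_shift (pathy j)).
have := causal_xy 1%N isT; rewrite now !shiftE.
apply: cond_indep_eq_law.
- by move=> S; exact: shifted_path_law.
- exact: sigma_family_sub (@measurable_coord _ _ X Y).
- exact: sigma_family_sub (@measurable_coord _ _ X Y).
- exact: sigma_family_sub (@measurable_present_coord _ _ X Y).
Qed.
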